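(* Let $n>1$ be an odd integer and $a$ an indeterminate, and let $M=(n+1)/2$ or $M=n-1$. Then $$ \sum_{k=0}^{M}[4k-1]_{q^2}[4k-1]^2\frac{(q^{-2};q^4)_k^2(q^{-2}/a;q^4)_k(aq^{-2};q^4)_k} {(q^4;q^4)_k^2(q^4/a;q^4)_k(aq^4;q^4)_k}q^{4k}\equiv 0 \pmod{[n]_{q^2}^2(1-aq^{2n})(a-q^{2n})}. $$
   Context: $q$ and $a$ are indeterminates. For an integer $m$, $[m]=[m]_q=(1-q^m)/(1-q)$ and $[m]_{q^2}=(1-q^{2m})/(1-q^2)$. The $q$-shifted factorial is $(x;q)_0=1$ and $(x;q)_k=(1-x)(1-xq)\cdots(1-xq^{k-1})$ for $k\ge1$. A congruence of rational functions in $q,a$ modulo a polynomial $P$ means the difference of the two sides is a rational function whose denominator is coprime to $P$ and whose numerator is divisible by $P$ (Laurent monomials in $q$ are allowed). *)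

(* Defs.v *)
From HB Require Import structures.
From mathcomp Require Import all_boot all_order all_algebra.
Set Implicit Arguments. Unset Strict Implicit. Unset Printing Implicit Defensive.
Import Order.TTheory GRing.Theory Num.Theory.
Local Open Scope ring_scope.

(* Polynomial ring Q[q][a]: inner variable q, outer variable a. *)
Definition R2 := {poly {poly rat}}.
Definition K2 := {fraction R2}.

Definition qR : R2 := ('X : {poly rat})%:P.
Definition aR : R2 := 'X.
Definition qK : K2 := tofrac qR.
Definition aK : K2 := tofrac aR.

Definition dvdR (x y : R2) : Prop := exists c : R2, y = c * x.
Definition coprimeR (x y : R2) : Prop :=
  forall g : R2, dvdR g x -> dvdR g y -> g \is a GRing.unit.

Definition congr0 (r : K2) (P : R2) : Prop :=
  exists N D : R2, D != 0 /\ coprimeR D P /\ dvdR P N /\ r = tofrac N / tofrac D.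

Definition qint (x : K2) (m : int) : K2 := (1 - x ^ m) / (1 - x).

Definition qpoch (x p : K2) (k : nat) : K2 := \prod_(i < k) (1 - x * p ^+ i).

Definition term4 (k : nat) : K2 :=
  let q := qK in let a := aK in
  qint (q ^+ 2) (4 * k%:Z - 1) * (qint q (4 * k%:Z - 1)) ^+ 2
  * (qpoch (q ^ (-2)) (q ^+ 4) k ^+ 2 * qpoch (q ^ (-2) / a) (q ^+ 4) k
      * qpoch (a * q ^ (-2)) (q ^+ 4) k)
  / (qpoch (q ^+ 4) (q ^+ 4) k ^+ 2 * qpoch (q ^+ 4 / a) (q ^+ 4) k
      * qpoch (a * q ^+ 4) (q ^+ 4) k)
  * q ^+ (4 * k).

(* [n]_{q^2} as a polynomial: 1 + q^2 + ... + q^(2(n-1)) = (1-q^(2n))/(1-q^2) *)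
Definition qintR2 (n : nat) : R2 := \sum_(i < n) qR ^+ (2 * i).

Definition modulus4 (n : nat) : R2 :=
  qintR2 n ^+ 2 * (1 - aR * qR ^+ (2 * n)) * (aR - qR ^+ (2 * n)).

(* Main.v *)
(** The sum is a balanced very-well-poised series with [A = q^-2], [b = c = q^3]
    in base [q^4]. Since [b c = A q^8], it is Gosper-summable: with [x = q^(4m)]
    the partial sum up to [m] is a product of ratios
      (1-q^(4i-2))^2 (1-a q^(4i-2)) (a-q^(4i-2))
        / ((1-q^(4i))^2 (1-a q^(4i)) (a-q^(4i))),  1 <= i <= m,
    times a polynomial quadratic in [x] over [q^4 (1-q)^2 (a q^2-1)(q^2-a)].
    For [m = M] the product contains the factors with [4i-2 = 2n], which gives
    [(1-a q^(2n)) (a-q^(2n))]. Writing [y = q^2], the remaining ratio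
    [(y;y^2)_M / (y^2;y^2)_M] is the Gaussian binomial [2M choose M] in [y] divided
    by [(-y;y)_M^2]; this binomial is divisible by [[n]_y], as one sees from
    [[2n-1]] binom(2n-2,n-1) = [[n]] binom(2n-1,n-1) when [M = n-1], and from
    [[M]] binom(2M,M) = [[n]] (1+y^M) binom(n-1,M-1) when [2M = n+1]. All denominators
    are prime to the modulus because [n] is odd. *)
From HB Require Import structures.
From mathcomp Require Import all_boot all_order all_algebra all_field.
From mathcomp Require Import ring zify.
Require Import Defs.
Set Implicit Arguments. Unset Strict Implicit. Unset Printing Implicit Defensive.
Import Order.TTheory GRing.Theory Num.Theory.
Local Open Scope ring_scope.

(* The solution of Gosper's equation, found by undetermined coefficients; the
   variable [x] stands for [q ^+ (4 * m)]. *)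
Definition cert (R : comPzRingType) (q a x : R) : R :=
  (2 * a * (1 + q ^+ 2) * q - (1 + a) ^+ 2 * q ^+ 2) * (q ^+ 2 * x ^+ 2 + 1)
  - x * (1 + q ^+ 2) * (a * (1 + q ^+ 2) ^+ 2 - 2 * q ^+ 2 * (1 + a) ^+ 2)
  - 2 * q ^+ 3 * (1 + a) ^+ 2 * x.

(** * Gosper summation over a field with generic [q] and [a] *)

Section Telescoping.
Variables (F : fieldType) (q a : F).
Hypothesis a_neq0 : a != 0.
Hypothesis q_inj : forall i j, (q ^+ i == q ^+ j) = (i == j).
Hypothesis aq_neq : forall i j, a * q ^+ i != q ^+ j.

Definition poch (x p : F) (k : nat) : F := \prod_(i < k) (1 - x * p ^+ i).

Definition wp_ratio (k : nat) : F :=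
  (poch (q ^ (-2)) (q ^+ 4) k ^+ 2 * poch (q ^ (-2) / a) (q ^+ 4) k
      * poch (a * q ^ (-2)) (q ^+ 4) k)
  / (poch (q ^+ 4) (q ^+ 4) k ^+ 2 * poch (q ^+ 4 / a) (q ^+ 4) k
      * poch (a * q ^+ 4) (q ^+ 4) k).

Definition summand (k : nat) : F :=
  (1 - (q ^+ 2) ^ (4 * k%:Z - 1)) / (1 - q ^+ 2)
  * ((1 - q ^ (4 * k%:Z - 1)) / (1 - q)) ^+ 2 * wp_ratio k * q ^+ (4 * k).

(** The factor [a - q ^+ j] is [1 - q ^+ j / a] cleared of its denominator; the extra factors [a]
    cancel in [tail_ratio]. *)
Definition tail_factor (j : nat) : F :=
  (1 - q ^+ j) ^+ 2 * (1 - a * q ^+ j) * (a - q ^+ j).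

Definition tail_ratio (k : nat) : F :=
  \prod_(i < k) (tail_factor (4 * i + 2) / tail_factor (4 * i + 4)).

Lemma q_neq0 : q != 0.
Proof. by apply/eqP=> q0; have := q_inj 1 2; rewrite q0 !expr0n /= eqxx. Qed.

Lemma subXX_neq0 i j : i != j -> q ^+ i - q ^+ j != 0.
Proof. by rewrite subr_eq0 q_inj. Qed.

Lemma subX_neq0 i : (0 < i)%N -> 1 - q ^+ i != 0.
Proof. by move=> i0; rewrite -(expr0 q) subXX_neq0 // eq_sym -lt0n. Qed.

Lemma subaX_neq0 i : 1 - a * q ^+ i != 0.
Proof. by rewrite subr_eq0 eq_sym -(expr0 q) aq_neq. Qed.

Lemma suba_neq0 i : a - q ^+ i != 0.
Proof. by rewrite subr_eq0; have := aq_neq 0 i; rewrite expr0 mulr1. Qed.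

Lemma qX4S m : q ^+ (4 * m.+1) = q ^+ 4 * q ^+ (4 * m).
Proof. by rewrite -exprD mulnS. Qed.

Lemma q2X4_neq0 m : q ^+ 2 - q ^+ (4 * m) != 0.
Proof. by apply: subXX_neq0; case: m => // m; rewrite mulnS. Qed.

Lemma aq2X4_neq0 m : a * q ^+ 2 - q ^+ (4 * m) != 0.
Proof. by rewrite subr_eq0 aq_neq. Qed.

Lemma q2aX4_neq0 m : q ^+ 2 - a * q ^+ (4 * m) != 0.
Proof. by rewrite subr_eq0 eq_sym aq_neq. Qed.

Lemma qm2 : q ^ (-2) = (q ^+ 2)^-1.
Proof. by rewrite -exprnN. Qed.

(** Shifting the numerator parameters by $q^4$ costs one boundary factor each: $(q^{-2};q^4)_m =
    (q^2;q^4)_m (q^2-1)/(q^2-x)$, and likewise for the parameters that contain $a$. *)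
Lemma wp_ratioE m : let x := q ^+ (4 * m) in
  wp_ratio m = tail_ratio m *
   ((q ^+ 2 - 1) ^+ 2 * (a * q ^+ 2 - 1) * (q ^+ 2 - a))
    / ((q ^+ 2 - x) ^+ 2 * (a * q ^+ 2 - x) * (q ^+ 2 - a * x)).
Proof.
have q0 := q_neq0.
elim: m => [|m IH] /=.
  rewrite /wp_ratio /tail_ratio /poch !big_ord0 muln0 expr0.
  have := q2X4_neq0 0; have := aq2X4_neq0 0; have := q2aX4_neq0 0.
  rewrite muln0 expr0 mulr1 => h1 h2 h3.
  by field; rewrite h1 h2 h3 oner_neq0.
have -> : wp_ratio m.+1 = wp_ratio m *
   ((1 - q ^ (-2) * q ^+ (4 * m)) ^+ 2 * (1 - q ^ (-2) / a * q ^+ (4 * m))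
    * (1 - a * q ^ (-2) * q ^+ (4 * m)) /
   ((1 - q ^+ 4 * q ^+ (4 * m)) ^+ 2 * (1 - q ^+ 4 / a * q ^+ (4 * m))
    * (1 - a * q ^+ 4 * q ^+ (4 * m)))).
  rewrite /wp_ratio /poch !big_ord_recr /= -!exprM.
  rewrite !exprMn !invfM; ring.
rewrite IH /tail_ratio big_ord_recr /= -/(tail_ratio m) /tail_factor.
have h1 := q2X4_neq0 m; have h2 := aq2X4_neq0 m; have h3 := q2aX4_neq0 m.
have h4 := q2X4_neq0 m.+1; have h5 := aq2X4_neq0 m.+1; have h6 := q2aX4_neq0 m.+1.
have h7 := @subX_neq0 (4 * m.+1) isT.
have h8 := subaX_neq0 (4 * m.+1).
have h9 := suba_neq0 (4 * m.+1).
move: h4 h5 h6 h7 h8 h9; rewrite !(exprD _ (4 * m)) qX4S.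
move: (q ^+ (4 * m)) (tail_ratio m) h1 h2 h3 => x E h1 h2 h3 h4 h5 h6 h7 h8 h9.
by rewrite qm2; field; rewrite !(mulrC x) h1 h2 h3 h4 h5 h6 h7 h8 h9 q0 a_neq0.
Qed.

Lemma summandE m : let x := q ^+ (4 * m) in
  summand m = (1 - x ^+ 2 / q ^+ 2) / (1 - q ^+ 2) * ((1 - x / q) / (1 - q)) ^+ 2
     * x * wp_ratio m.
Proof.
have q0 := q_neq0.
have e : q ^ (4 * m%:Z - 1) = q ^+ (4 * m) / q by rewrite expfzDr // -PoszM.
have e2 : (q ^+ 2) ^ (4 * m%:Z - 1) = (q ^+ (4 * m)) ^+ 2 / q ^+ 2.
  by rewrite exprnP exprzAC e -exprnP expr_div_n.
by rewrite /summand e e2 mulrAC.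
Qed.

Lemma sum_summand m :
  \sum_(k < m.+1) summand k = tail_ratio m * cert q a (q ^+ (4 * m))
    / (q ^+ 4 * (1 - q) ^+ 2 * (a * q ^+ 2 - 1) * (q ^+ 2 - a)).
Proof.
have q0 := q_neq0.
have h1 : 1 - q != 0 by apply: (@subX_neq0 1).
have h2 : 1 - q ^+ 2 != 0 by apply: (@subX_neq0 2).
have h3 : a * q ^+ 2 - 1 != 0 by rewrite subr_eq0 -(expr0 q) aq_neq.
have h4 : q ^+ 2 - a != 0 by rewrite subr_eq0 eq_sym -[a]mulr1 -(expr0 q) aq_neq.
elim: m => [|m IH] /=.
  rewrite big_ord_recr big_ord0 /= summandE /wp_ratio /tail_ratio /poch !big_ord0.
  rewrite /cert muln0 expr0.
  by field; rewrite h1 h2 h3 h4 q0 oner_neq0.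
rewrite big_ord_recr IH /= summandE wp_ratioE /tail_ratio big_ord_recr /=.
rewrite -/(tail_ratio m) /tail_factor /cert.
have h14 := q2X4_neq0 m.+1; have h5 := aq2X4_neq0 m.+1; have h6 := q2aX4_neq0 m.+1.
have h7 := @subX_neq0 (4 * m.+1) isT.
have h8 := subaX_neq0 (4 * m.+1).
have h9 := suba_neq0 (4 * m.+1).
move: h14 h5 h6 h7 h8 h9; rewrite !(exprD _ (4 * m)) qX4S.
(* Once [q ^+ (4 * m)] is a free variable, the induction step is Gosper's equation for [cert], an
   identity of rational functions in $q$, $a$, $x$. *)
move: (q ^+ (4 * m)) (tail_ratio m) => x E h14 h5 h6 h7 h8 h9.
by field; rewrite !(mulrC x) h1 h2 h3 h4 h5 h6 h7 h8 h9 h14 q0.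
Qed.

End Telescoping.

(** * $q$-factorials and Gaussian binomials *)

Section QProducts.
Variables (R : comPzRingType) (x : R).

Definition qfact (k : nat) : R := \prod_(i < k) (1 - x ^+ i.+1).
Definition qodd (k : nat) : R := \prod_(i < k) (1 - x ^+ (2 * i + 1)).
Definition qeven (k : nat) : R := \prod_(i < k) (1 - x ^+ (2 * i + 2)).
Definition qplus (k : nat) : R := \prod_(i < k) (1 + x ^+ i.+1).
Definition qnum (n : nat) : R := \sum_(i < n) x ^+ i.

End QProducts.

Section QFactorial.
Variables (R : idomainType) (x : R).
Hypothesis x_nonroot : forall i, 1 - x ^+ i.+1 != 0.

Lemma qfactS k : qfact x k.+1 = qfact x k * (1 - x ^+ k.+1).
Proof. by rewrite /qfact big_ord_recr. Qed.

Lemma qfact_neq0 k : qfact x k != 0.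
Proof. by apply/prodf_neq0. Qed.

(** The $q$-Pascal rule, by induction on $a+b$. The cofactor [c] is the Gaussian binomial, obtained
    inside the ring without division. *)
Lemma qbinom_exists a b : exists c, qfact x (a + b) = c * (qfact x a * qfact x b).
Proof.
have [m] := ubnP (a + b); elim: m a b => // m IH [|a] [|b] lt_ab.
- by exists 1; rewrite /qfact big_ord0 !mul1r.
- by exists 1; rewrite /qfact big_ord0 !mul1r.
- by exists 1; rewrite addn0 /qfact big_ord0 mulr1 !mul1r.
have [c1 e1] := IH a b.+1 ltac:(lia).
have [c2 e2] := IH a.+1 b ltac:(lia).
exists (c1 + x ^+ a.+1 * c2).
rewrite -[(a.+1 + b.+1)%N]/((a + b.+1).+1) qfactS.
have -> : x ^+ (a + b.+1).+1 = x ^+ a.+1 * x ^+ b.+1 by rewrite -exprD.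
have -> : 1 - x ^+ a.+1 * x ^+ b.+1
    = (1 - x ^+ a.+1) + x ^+ a.+1 * (1 - x ^+ b.+1) by ring.
by rewrite mulrDr {1}e1 -addSnnS e2 !qfactS; ring.
Qed.

Lemma qevenE k : qeven x k = qfact x k * qplus x k.
Proof.
rewrite /qeven /qfact /qplus -big_split; apply: eq_bigr => i _ /=.
have -> : (2 * i + 2 = i.+1 * 2)%N by lia.
rewrite exprM; ring.
Qed.

Lemma qodd_even k : qodd x k * qeven x k = qfact x (k + k).
Proof.
elim: k => [|k IH]; first by rewrite /qodd /qeven /qfact !big_ord0 mulr1.
rewrite addSn addnS !qfactS -IH /qodd /qeven !big_ord_recr /=.
have -> : (2 * k + 1 = (k + k).+1)%N by lia.
have -> : (2 * k + 2 = (k + k).+2)%N by lia.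
ring.
Qed.

Lemma qeven_neq0 k : qeven x k != 0.
Proof. by apply/prodf_neq0 => i _; rewrite addn2. Qed.

(** Division-free form of $(x;x^2)_k/(x^2;x^2)_k = c/(-x;x)_k^2$, where [c] is the central Gaussian
    binomial. *)
Lemma qodd_plus k c : qfact x (k + k) = c * (qfact x k * qfact x k) ->
  qodd x k * qplus x k ^+ 2 = c * qeven x k.
Proof.
rewrite -qodd_even => e; apply: (mulIf (qeven_neq0 k)).
by rewrite mulrAC e {1 2}qevenE; ring.
Qed.

Lemma qnumE n : 1 - x ^+ n = (1 - x) * qnum x n.
Proof. by rewrite -opprB subrX1 -mulNr opprB. Qed.

End QFactorial.

(** * Coprimality to $[n]_{q^2}$ in $\mathbb{Q}[q]$, tested on algebraic roots *)

Lemma coprimep_ratP (p r : {poly rat}) :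
  (forall z : algC, root (map_poly ratr p) z -> ~~ root (map_poly ratr r) z) ->
  coprimep p r.
Proof.
move=> h; rewrite -(coprimep_map (ratr : {rmorphism rat -> algC})).
by apply/Pdiv.ClosedField.coprimepP.
Qed.

Local Notation qnumX2 n := (qnum ('X ^+ 2 : {poly rat}) n).

(** At $z^2=1$ the value is $n \ne 0$, so only the nontrivial $n$-th roots of unity remain for
    $z^2$. *)
Lemma root_qnum n (z : algC) : (0 < n)%N -> root (map_poly ratr (qnumX2 n)) z ->
  (z ^+ 2) ^+ n = 1 /\ z ^+ 2 != 1.
Proof.
move=> n_gt0 /rootP.
have -> : (map_poly ratr (qnumX2 n)).[z] = qnum (z ^+ 2) n.
  rewrite /qnum rmorph_sum horner_sum; apply: eq_bigr => i _.
  by rewrite !rmorphXn /= map_polyX !hornerE.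
move=> e; split; first by apply/eqP; rewrite eq_sym -subr_eq0 qnumE e mulr0.
apply/eqP=> z1; move: e; rewrite /qnum z1.
under eq_bigr do rewrite expr1n.
by rewrite sumr_const card_ord => /eqP; rewrite pnatr_eq0 gtn_eqF.
Qed.

Lemma coprimep_qnum m n : (0 < m)%N -> (0 < n)%N -> coprime m n ->
  coprimep (qnumX2 m) (qnumX2 n).
Proof.
move=> m0 n0 /eqP cop; apply: coprimep_ratP => z /(root_qnum m0)[zm z1].
apply/negP=> /(root_qnum n0)[zn _].
case/eqP: z1; have [u v e _] := egcdnP n m0.
have : (z ^+ 2) ^+ (u * m) = (z ^+ 2) ^+ (v * n + gcdn m n) by rewrite e.
rewrite cop exprD expr1 (mulnC u) (mulnC v).
by rewrite (exprM _ m) (exprM _ n) zm zn !expr1n mul1r.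
Qed.

(** At a common root, $y=z^2$ has $y^n=1$ and $y^{j+1}=-1$, whence $1=(-1)^n=-1$ for odd $n$. *)
Lemma coprimep_plus j n : odd n -> coprimep (1 + 'X ^+ 2 ^+ j.+1) (qnumX2 n).
Proof.
move=> on; apply: coprimep_ratP => z /rootP.
rewrite rmorphD rmorph1 !rmorphXn /= map_polyX !hornerE => /eqP.
rewrite addrC addr_eq0 => /eqP e.
apply/negP=> /(root_qnum (odd_gt0 on))[zn _].
have : ((z ^+ 2) ^+ n) ^+ j.+1 = 1 by rewrite zn expr1n.
rewrite exprAC e -signr_odd on expr1 => /eqP.
by rewrite -subr_eq0 -opprD oppr_eq0 -(natrD _ 1 1) pnatr_eq0.
Qed.

Lemma coprimep_X_qnum n : (0 < n)%N -> coprimep 'X (qnumX2 n).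
Proof.
move=> n0; apply: coprimep_ratP => z /rootP; rewrite map_polyX hornerX => ->.
by apply/negP=> /(root_qnum n0)[]; rewrite expr0n expr0n gtn_eqF // => /esym/eqP;
  rewrite oner_eq0.
Qed.

Lemma coprimep_1X_qnum n : (0 < n)%N -> coprimep (1 - 'X) (qnumX2 n).
Proof.
move=> n0; apply: coprimep_ratP => z /rootP.
rewrite rmorphB rmorph1 /= map_polyX !hornerE => /eqP; rewrite subr_eq0 => /eqP <-.
by apply/negP=> /(root_qnum n0)[_]; rewrite expr1n eqxx.
Qed.

Lemma subX2_neq0 i : 1 - 'X ^+ 2 ^+ i.+1 != 0 :> {poly rat}.
Proof.
rewrite -exprM subr_eq0; apply/eqP => /(congr1 (size : {poly rat} -> nat)).
by rewrite size_polyXn size_poly1.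
Qed.

(** * Divisibility of the central Gaussian binomial by $[n]_{q^2}$ *)

Lemma coprime_double1 k m : (2 * m = k.+1)%N -> coprime k m.
Proof.
move=> e; rewrite /coprime -dvdn1.
have := dvdn_sub (dvdn_mull 2 (dvdn_gcdr k m)) (dvdn_gcdl k m).
by rewrite e subSn // subnn.
Qed.

Lemma qnum_dvd_qbinom (n M : nat) (c : {poly rat}) : odd n -> (1 < n)%N ->
  (M = n.+1 %/ 2 \/ M = n.-1)%N ->
  qfact ('X ^+ 2) (M + M) = c * (qfact ('X ^+ 2) M * qfact ('X ^+ 2) M) ->
  qnumX2 n %| c.
Proof.
set x := 'X ^+ 2; move=> on n1 hM e.
have x1 : 1 - x != 0 := subX2_neq0 0.
have f0 k : qfact x k != 0 by apply: qfact_neq0 => i; exact: subX2_neq0.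
case: hM => hM.
  case: M hM e => [|k] hM; first lia.
  have {}hM : n = (k + k).+1 by lia.
  have [c' e'] := qbinom_exists x k k.
  rewrite addSn addnS !qfactS e' -hM => e.
  (* Here $M=k+1$ and [c'] is binom(n-1,M-1). Since $2M=n+1$, $[M]$ is prime to $[n]$ and may
     multiply [c]. *)
  rewrite -(@Gauss_dvdpl _ _ (qnumX2 k.+1)); last first.
    by apply: coprimep_qnum; [lia | lia | apply: coprime_double1; lia].
  apply/dvdpP; exists (c' * (1 + x ^+ k.+1)).
  apply: (mulIf x1); apply: (mulIf (subX2_neq0 k)); apply: (mulIf (f0 k)).
  apply: (mulIf (f0 k)).
  have -> : c * qnumX2 k.+1 * (1 - x) = c * (1 - x ^+ k.+1) by rewrite (qnumE x k.+1); ring.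
  have -> : c' * (1 + x ^+ k.+1) * qnumX2 n * (1 - x)
      = c' * (1 + x ^+ k.+1) * (1 - x ^+ n) by rewrite (qnumE x n); ring.
  have e2 : n.+1 = (k.+1 * 2)%N by lia.
  transitivity (c * (qfact x k * (1 - x ^+ k.+1) * (qfact x k * (1 - x ^+ k.+1)))).
    by rewrite -/x; ring.
  by rewrite -e e2 exprM -/x; ring.
have [c' e'] := qbinom_exists x n M.
(* Here $M+n=2n-1$ is prime to $n$, and [c'] is binom(2n-1,n-1). *)
rewrite -(@Gauss_dvdpl _ _ (qnumX2 (M + n))); last first.
  by apply: coprimep_qnum; [lia | lia | rewrite coprime_sym; apply: coprime_double1; lia].
apply/dvdpP; exists c'.
apply: (mulIf x1); apply: (mulIf (f0 M)); apply: (mulIf (f0 M)).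
have -> : c * qnumX2 (M + n) * (1 - x) = c * (1 - x ^+ (M + n)) by rewrite (qnumE x (M + n)); ring.
have -> : c' * qnumX2 n * (1 - x) = c' * (1 - x ^+ n) by rewrite (qnumE x n); ring.
have e2 : (M + n = (M + M).+1)%N by lia.
have en : n = M.+1 by lia.
move: e'; rewrite addnC e2 qfactS e en qfactS => e'.
transitivity (c * (qfact x M * qfact x M) * (1 - x ^+ (M + M).+1)); first by ring.
by rewrite e'; ring.
Qed.

Lemma qintR2E n : qintR2 n = (qnumX2 n)%:P.
Proof.
rewrite /qintR2 /qnum rmorph_sum; apply: eq_bigr => i _.
by rewrite /qR -rmorphXn /= exprM.
Qed.

Lemma qnumX2_neq0 n : (0 < n)%N -> qnumX2 n != 0.
Proof.
case: n => // n _; have := subX2_neq0 n; rewrite (qnumE 'X^2).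
by apply: contraNneq => ->; rewrite mulr0.
Qed.

Lemma sub1XC (F : fieldType) (c : F) : c != 0 ->
  1 - 'X * c%:P = - c *: ('X - (c^-1)%:P).
Proof.
move=> c0; have e1 : c%:P * (c^-1)%:P = 1 by rewrite -polyCM mulfV.
by rewrite -mul_polyC polyCN -e1; ring.
Qed.

(** * The partial sum as a single fraction *)

(** [p] stands for $(-q^2;q^2)_m$, and [c] in [sum_num] for the central Gaussian binomial in $q^2$.
    Any commutative ring is allowed so that both formulas can be moved along embeddings and
    evaluations in $a$. *)
Definition sum_den (R : comPzRingType) (p q a : R) (m : nat) : R :=
  p ^+ 4 * \prod_(i < m) ((1 - a * q ^+ (4 * i + 4)) * (a - q ^+ (4 * i + 4)))
  * (q ^+ 4 * (1 - q) ^+ 2 * (a * q ^+ 2 - 1) * (q ^+ 2 - a)).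

Definition sum_num (R : comPzRingType) (c q a : R) (m : nat) : R :=
  c ^+ 2 * \prod_(i < m) ((1 - a * q ^+ (4 * i + 2)) * (a - q ^+ (4 * i + 2)))
  * cert q a (q ^+ (4 * m)).

Lemma addX2_neq0 i : 1 + 'X ^+ 2 ^+ i.+1 != 0 :> {poly rat}.
Proof.
rewrite -exprM addrC; apply/eqP => /(congr1 (fun p : {poly rat} => p.[1])).
by rewrite !hornerE expr1n => /eqP; rewrite -(natrD _ 1 1) pnatr_eq0.
Qed.

Section Morphism.
Variables (R S : comPzRingType) (h : {rmorphism R -> S}).

Lemma rmorph_sum_den p q a m : h (sum_den p q a m) = sum_den (h p) (h q) (h a) m.
Proof.
rewrite /sum_den !(rmorphM, rmorphXn, rmorphB, rmorph1) rmorph_prod.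
congr (_ * _ * _); apply: eq_bigr => i _.
by rewrite !(rmorphM, rmorphXn, rmorphB, rmorph1).
Qed.

Lemma rmorph_sum_num c q a m : h (sum_num c q a m) = sum_num (h c) (h q) (h a) m.
Proof.
rewrite /sum_num /cert !(rmorphM, rmorphXn, rmorphB, rmorphD, rmorph1) rmorph_prod.
congr (_ * _ * _); apply: eq_bigr => i _.
by rewrite !(rmorphM, rmorphXn, rmorphB, rmorph1).
Qed.

Lemma rmorph_qodd x m : h (qodd x m) = qodd (h x) m.
Proof. by rewrite rmorph_prod; apply: eq_bigr => i _; rewrite rmorphB rmorph1 rmorphXn. Qed.

Lemma rmorph_qeven x m : h (qeven x m) = qeven (h x) m.
Proof. by rewrite rmorph_prod; apply: eq_bigr => i _; rewrite rmorphB rmorph1 rmorphXn. Qed.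

End Morphism.

(** The factors containing $a$ have exponents $2j$ with $j=1$ or $j$ even, so $j=n$ never occurs for
    odd $n>1$. Hence $a=q^{\pm 2n}$ is not excluded. *)
Lemma sum_den_neq0 (F : fieldType) (p q a : F) n m : odd n -> (1 < n)%N ->
  p != 0 -> q != 0 -> q != 1 ->
  (forall j, (0 < j)%N -> j != n -> a * q ^+ (2 * j) != 1 /\ a != q ^+ (2 * j)) ->
  sum_den p q a m != 0.
Proof.
move=> on n1 p0 q0 q1 ha.
have hP : \prod_(i < m) ((1 - a * q ^+ (4 * i + 4)) * (a - q ^+ (4 * i + 4))) != 0.
  apply/prodf_neq0 => i _.
  have [] := ha (2 * i + 2)%N ltac:(lia) ltac:(lia).
  have -> : (2 * (2 * i + 2) = 4 * i + 4)%N by lia.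
  by move=> h1 h2; rewrite mulf_neq0 // subr_eq0 // eq_sym.
have [h1 h2] := ha 1%N isT ltac:(lia).
have h3 : a * q ^+ 2 - 1 != 0 by rewrite subr_eq0.
have h4 : q ^+ 2 - a != 0 by rewrite subr_eq0 eq_sym.
have h5 : 1 - q != 0 by rewrite subr_eq0 eq_sym.
by rewrite /sum_den !mulf_neq0 ?expf_neq0.
Qed.

Section ClosedForm.
Variables (F : fieldType) (q a : F).
Hypothesis a_neq0 : a != 0.
Hypothesis q_inj : forall i j, (q ^+ i == q ^+ j) = (i == j).
Hypothesis aq_neq : forall i j, a * q ^+ i != q ^+ j.

Lemma sum_summand_closed p c m : sum_den p q a m != 0 ->
  qodd (q ^+ 2) m * p ^+ 2 = c * qeven (q ^+ 2) m ->
  \sum_(k < m.+1) summand q a k = sum_num c q a m / sum_den p q a m.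
Proof.
rewrite /sum_den (mulf_eq0 (_ ^+ _ * _)) (mulf_eq0 (p ^+ _)) (mulf_eq0 (_ * _ * _)).
rewrite (mulf_eq0 (_ ^+ _ * _)) (mulf_eq0 (q ^+ _)) !negb_or !expf_eq0 /=.
move=> /andP[/andP[p0 P0] /andP[/andP[/andP[q0 q1] aq] qa]] e.
have e0 : qeven (q ^+ 2) m != 0.
  by apply/prodf_neq0 => i _; rewrite -exprM; apply: subX_neq0 => //; lia.
(* [r = 1] gives the numerators of [tail_ratio] and [r = 2] the denominators; the squared products
   are [qodd] and [qeven] at $q^2$. *)
have tfE r : \prod_(i < m) tail_factor q a (4 * i + (2 * r))
   = (\prod_(i < m) (1 - (q ^+ 2) ^+ (2 * i + r))) ^+ 2
    * \prod_(i < m) ((1 - a * q ^+ (4 * i + 2 * r)) * (a - q ^+ (4 * i + 2 * r))).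
  rewrite -prodrXl -big_split /=; apply: eq_bigr => i _.
  have -> : (4 * i + 2 * r = 2 * (2 * i + r))%N by lia.
  by rewrite /tail_factor exprM mulrA.
rewrite sum_summand // /tail_ratio prodf_div (tfE 1) (tfE 2).
rewrite -/(qodd _ _) -/(qeven _ _) /sum_num /sum_den.
have -> : qodd (q ^+ 2) m = c * qeven (q ^+ 2) m / p ^+ 2.
  by rewrite -e mulfK // expf_neq0.
rewrite !invfM !exprMn !exprVn; field.
by rewrite p0 P0 q0 q1 aq qa e0.
Qed.

End ClosedForm.

(** * Coprimality of the denominator to the modulus in $\mathbb{Q}[q][a]$ *)

Section CoprimeModulus.
Variables (F : fieldType) (f : {rmorphism {poly rat} -> F}).
Hypothesis f_inj : injective f.

(* Over the field of fractions in [q], the two hypotheses on roots leave only common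
   divisors of degree 0 in [a]; such a divisor divides every value at a point of
   [{poly rat}], and the values of the modulus at 0 and 1 generate [[n]^2]. *)
Lemma coprimeR_modulus4 n (D : R2) : (0 < n)%N ->
  coprimep D.[0] (qnumX2 n) ->
  ~~ root (map_poly f D) (f 'X ^+ (2 * n)) ->
  ~~ root (map_poly f D) (f 'X ^- (2 * n)) ->
  coprimeR D (modulus4 n).
Proof.
move=> n0 cop0 nr1 nr2 g [u Du] [v Pv].
set c := f 'X ^+ (2 * n) in nr1 nr2.
have c0 : c != 0.
  by rewrite expf_neq0 // -(rmorph0 f) (inj_eq f_inj) polyX_eq0.
have fq : map_poly f (qR ^+ (2 * n)) = c%:P.
  by rewrite /qR -rmorphXn /= map_polyC /= rmorphXn.
have fP : map_poly f (modulus4 n)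
    = (f (qnumX2 n))%:P ^+ 2 * (1 - 'X * c%:P) * ('X - c%:P).
  rewrite /modulus4 qintR2E /aR (rmorphM _ (_ * _)) (rmorphM _ (_ ^+ _)) rmorphXn.
  by rewrite !rmorphB rmorph1 (rmorphM _ 'X) /= fq map_polyX map_polyC.
have copF : coprimep (map_poly f D) (map_poly f (modulus4 n)).
  rewrite fP coprimepMr coprimep_XsubC nr1 andbT coprimepMr.
  apply/andP; split.
    apply: coprimep_expr; rewrite -alg_polyC coprimepZr ?coprimep1 //.
    by rewrite -(rmorph0 f) (inj_eq f_inj) qnumX2_neq0.
  by rewrite (sub1XC c0) coprimepZr ?oppr_eq0 // coprimep_XsubC.
have g_const : size g = 1.
  have : map_poly f g %= 1.
    by move: copF; rewrite Du Pv !rmorphM /= => /coprimepP; apply; exact: dvdp_mull.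
  by rewrite -size_poly_eq1 size_map_inj_poly ?rmorph0 // => /eqP.
have [g0 _ Eg] := size_poly1P _ (introT eqP g_const).
have dD : g0 %| D.[0] by rewrite Du Eg hornerM hornerC dvdp_mull.
have dP y : g0 %| (modulus4 n).[y] by rewrite Pv Eg hornerM hornerC dvdp_mull.
have mE y : (modulus4 n).[y]
    = qnumX2 n ^+ 2 * (1 - y * 'X ^+ (2 * n)) * (y - 'X ^+ (2 * n)).
  rewrite /modulus4 qintR2E /aR /qR -!rmorphXn /= !hornerM !hornerD !hornerN.
  by rewrite hornerM !hornerC hornerX.
(* With $t=q^{2n}$ this is $(1-t)^2+(2-t)t=1$. *)
have e : qnumX2 n ^+ 2 = (modulus4 n).[1] - (2 - 'X ^+ (2 * n)) * (modulus4 n).[0].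
  by rewrite !mE; ring.
have d2 : g0 %| qnumX2 n ^+ 2 by rewrite e dvdp_sub // dvdp_mull.
have /coprimepP/(_ _ dD d2) g01 := coprimep_expr 2 cop0.
have [r r0 Er] : exists2 r, r != 0 & g0 = r%:P by apply/size_poly1P; rewrite size_poly_eq1.
by rewrite Eg Er; do 2!apply: rmorph_unit; rewrite unitfE.
Qed.

Lemma fX_inj i j : (f 'X ^+ i == f 'X ^+ j) = (i == j).
Proof.
rewrite -!rmorphXn (inj_eq f_inj); apply/eqP/eqP => [|-> //].
by move/(congr1 (size : {poly rat} -> nat)); rewrite !size_polyXn => -[].
Qed.

Lemma root_sum_den n M (y : F) : odd n -> (1 < n)%N ->
  (forall j, (0 < j)%N -> j != n -> y * f 'X ^+ (2 * j) != 1 /\ y != f 'X ^+ (2 * j)) ->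
  ~~ root (map_poly f (sum_den (qplus ('X ^+ 2) M)%:P qR aR M)) y.
Proof.
move=> on n1 hy; rewrite -[root _ _]/(horner_eval y _ == 0).
rewrite 2!rmorph_sum_den /= /horner_eval /aR /qR !map_polyC map_polyX !hornerC hornerX.
apply: (sum_den_neq0 _ on n1) hy.
- rewrite -(rmorph0 f) (inj_eq f_inj); apply/prodf_neq0 => i _.
  exact: addX2_neq0.
- by rewrite -(rmorph0 f) (inj_eq f_inj) polyX_eq0.
- by rewrite (fX_inj 1 0).
Qed.

Lemma coprimeR_den n M : odd n -> (1 < n)%N ->
  coprimeR (sum_den (qplus ('X ^+ 2) M)%:P qR aR M) (modulus4 n).
Proof.
move=> on n1; have n0 := odd_gt0 on.
have t0 : f 'X != 0 by rewrite -(rmorph0 f) (inj_eq f_inj) polyX_eq0.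
have t1 i : (0 < i)%N -> f 'X ^+ i != 1 by rewrite lt0n (fX_inj i 0).
apply: coprimeR_modulus4 => //.
(* At $a=0$ the denominator is, up to sign, a product of powers of $q$, $1-q$ and the $1+q^{2j}$,
   all prime to $[n]_{q^2}$. *)
- rewrite -[_.[0]]/(horner_eval 0 _) rmorph_sum_den /= /horner_eval !hornerC hornerX.
  rewrite /sum_den !mul0r !sub0r subr0.
  have cX i : coprimep ('X ^+ i) (qnumX2 n) by rewrite coprimep_expl ?coprimep_X_qnum.
  have cN p : coprimep (- p) (qnumX2 n) = coprimep p (qnumX2 n).
    by rewrite -scaleN1r coprimepZl ?oppr_eq0 ?oner_eq0.
  have cM p r : coprimep p (qnumX2 n) -> coprimep r (qnumX2 n) -> coprimep (p * r) (qnumX2 n).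
    by rewrite coprimepMl => -> ->.
  apply: (cM (_ * _)); last first.
    apply: (cM (_ * _)) => //; apply: (cM (_ * _)); last by rewrite cN coprime1p.
    by apply: cM => //; apply/coprimep_expl/coprimep_1X_qnum.
  apply: (cM (_ ^+ _)).
    apply: coprimep_expl; rewrite /qplus; elim/big_ind: _ => [|p r|i _].
    - exact: coprime1p.
    - exact: cM.
    - exact: coprimep_plus.
  elim/big_ind: _ => [|p r|i _]; [exact: coprime1p | exact: cM |].
  by rewrite mul0r subr0 mul1r sub0r cN.
- apply: (root_sum_den M on n1) => j j0 jn.
  by rewrite -exprD fX_inj; split; [apply: t1; lia | lia].
- apply: (root_sum_den M on n1) => j j0 jn; split.
    (* At $a=q^{-2n}$, multiplying by $q^{2n}$ restores nonnegative exponents. *)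
    rewrite -(inj_eq (mulfI (expf_neq0 (2 * n) t0))) mulVKf ?expf_neq0 //.
    by rewrite mulr1 fX_inj; lia.
  rewrite -(inj_eq (mulfI (expf_neq0 (2 * n) t0))) mulfV ?expf_neq0 //.
  by rewrite -exprD eq_sym; apply: t1; lia.
Qed.

End CoprimeModulus.

(** For odd $n$ the index $i=(n-1)/2$ has $4i+2=2n$, so its factor supplies $(1-aq^{2n})(a-q^{2n})$;
    $[n]_{q^2}^2$ comes from the squared binomial. *)
Lemma dvdR_num n M (d : {poly rat}) : odd n -> (n./2 < M)%N ->
  dvdR (modulus4 n) (sum_num (d * qnumX2 n)%:P qR aR M).
Proof.
move=> on lt_M; rewrite /modulus4 qintR2E /sum_num (bigD1 (Ordinal lt_M)) //= polyCM.
have -> : (4 * n./2 + 2 = 2 * n)%N by lia.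
set P := \prod_(i | _) _; exists (d%:P ^+ 2 * P * cert qR aR (qR ^+ (4 * M))).
by rewrite exprMn; ring.
Qed.

(** * Assembly in $\mathbb{Q}(q,a)$ *)

Lemma qK_inj i j : (qK ^+ i == qK ^+ j) = (i == j).
Proof.
rewrite /qK /qR -!tofracXn tofrac_eq -!rmorphXn (inj_eq (@polyC_inj _)) /=.
apply/eqP/eqP => [|-> //].
by move/(congr1 (size : {poly rat} -> nat)); rewrite !size_polyXn => -[].
Qed.

Lemma aqK_neq i j : aK * qK ^+ i != qK ^+ j.
Proof.
rewrite /aK /qK /aR /qR -!tofracXn -tofracM tofrac_eq -!rmorphXn /=.
apply/eqP => /(congr1 (fun p : R2 => p.[0])); rewrite hornerM hornerX mul0r hornerC.
by move/esym/eqP; rewrite expf_eq0 polyX_eq0 andbF.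
Qed.

Theorem theorem4 (n M : nat) :
  odd n -> (1 < n)%N -> (M = n.+1 %/ 2 \/ M = n.-1)%N ->
  congr0 (\sum_(k < M.+1) term4 k) (modulus4 n).
Proof.
move=> on n1 hM.
have [c ec] := qbinom_exists ('X ^+ 2 : {poly rat}) M M.
have /dvdpP[d Ed] := qnum_dvd_qbinom on n1 hM ec.
have eo := qodd_plus subX2_neq0 ec; rewrite {}Ed in eo.
exists (sum_num (d * qnumX2 n)%:P qR aR M), (sum_den (qplus ('X ^+ 2) M)%:P qR aR M).
have p0 : qplus ('X ^+ 2 : {poly rat}) M != 0.
  by apply/prodf_neq0 => i _; exact: addX2_neq0.
have cop : coprimeR (sum_den (qplus ('X ^+ 2) M)%:P qR aR M) (modulus4 n).
  apply: (@coprimeR_den _ (@tofrac {poly rat})) => // x y /eqP.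
  by rewrite tofrac_eq => /eqP.
pose h : {rmorphism {poly rat} -> K2} := @tofrac R2 \o polyC.
have D0 : sum_den (h (qplus ('X ^+ 2) M)) qK aK M != 0.
  (* In this field $a$ is never a power of $q^{\pm 1}$, so no exponent needs excluding; 3 is an
     arbitrary odd number above 1. *)
  apply: (@sum_den_neq0 _ _ _ _ 3) => //.
  - by rewrite tofrac_eq0 polyC_eq0.
  - by rewrite tofrac_eq0 polyC_eq0 polyX_eq0.
  - by rewrite (qK_inj 1 0).
  - move=> j _ _; split; first by have := aqK_neq (2 * j) 0.
    by have := aqK_neq 0 (2 * j); rewrite expr0 mulr1.
have eh : qodd (qK ^+ 2) M * h (qplus ('X ^+ 2) M) ^+ 2 = h (d * qnumX2 n) * qeven (qK ^+ 2) M.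
  have := congr1 h eo; rewrite (rmorphM h (qodd _ _)) (rmorphM h (_ * _)).
  by rewrite rmorphXn rmorph_qodd rmorph_qeven rmorphXn.
have hD : tofrac (sum_den (qplus ('X ^+ 2) M)%:P qR aR M)
    = sum_den (h (qplus ('X ^+ 2) M)) qK aK M.
  exact: (rmorph_sum_den (@tofrac R2)).
split; first by rewrite -tofrac_eq0 hD.
split=> //; split; first by apply: dvdR_num => //; lia.
have <- : \sum_(k < M.+1) summand qK aK k = \sum_(k < M.+1) term4 k.
  by apply: eq_bigr => k _; rewrite /summand /wp_ratio mulrA.
rewrite (sum_summand_closed _ qK_inj aqK_neq D0 eh).
  by rewrite hD (rmorph_sum_num (@tofrac R2)).
by rewrite tofrac_eq0 polyX_eq0.
Qed.
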